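(* Consider the one-dimensional discrimination task described in the context, with state space $\Theta=\{\theta_1<\dots<\theta_n\}\subset\mathbb{R}$ (equally spaced), full-support prior $\pi$, and actions $A=\{r,s\}$, and a nest structure $(N,\nu)$ for $\pi$ with $N=\{1,\dots,n\}$. Let $\zeta>0$ and let costs be posterior-separable with entropy function $$H_\pi(p)=\inf\Big\{\zeta D_{\mathrm{KL}}(\bar\mu\Vert\bar\nu):\ \bar\mu\in\Delta(N),\ \sum_{i\in N}\bar\mu(i)\nu_i=p\Big\}.$$ Suppose $\{\nu_i:i\in N\}$ is affinely independent. The psychometric function $\theta\mapsto P_\theta(r)$ of an optimal choice rule $P$ has the following properties: (i) The psychometric function is increasing if the nest structure satisfies the monotone likelihood ratio property (MLRP): $\theta\ge\tau$ and $i\ge j$ implies $\nu_\theta(i)\nu_\tau(j)\ge\nu_\tau(i)\nu_\theta(j)$. (ii) Assume the MLRP. The psychometric function is convex at $\theta_i$ (for $1<i<n$) if $\frac12\nu_{\theta_{i-1}}+\frac12\nu_{\theta_{i+1}}$ first-order stochastically dominates $\nu_{\theta_i}$. (iii) Assume the MLRP. The psychometric function is concave at $\theta_i$ (for $1<i<n$) if $\nu_{\theta_i}$ first-order stochastically dominates $\frac12\nu_{\theta_{i-1}}+\frac12\nu_{\theta_{i+1}}$.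
   Context: Task: $\theta_{i+1}-\theta_i=\Delta>0$ for all $i$. The risky action $r$ has utilities $r(\theta)$ weakly increasing in $\theta$; the safe action $s$ has $s(\theta)=0$ for all $\theta$. A nest structure $(N,\nu)$ for $\pi$: a joint distribution $\nu\in\Delta(N\times\Theta)$ whose marginal $\bar\nu$ on $N$ has full support and whose marginal on $\Theta$ is $\pi$; $\nu_i\in\Delta(\Theta)$ is the conditional distribution on states given $i\in N$, and $\nu_\theta(j)=\nu(j,\theta)/\pi(\theta)$ defines the conditional distribution $\nu_\theta\in\Delta(N)$. Affine independence refers to the indexed family $(\nu_i)_{i\in N}$. The infimum over the empty set is $+\infty$; $D_{\mathrm{KL}}(\beta\Vert\alpha)=\sum_x\beta(x)\log(\beta(x)/\alpha(x))$. First-order stochastic dominance is with respect to the usual order on $N=\{1,\dots,n\}$. ''Increasing'' is weak. Posterior-separable cost: $C(P,\pi)=\sum_{a\in\operatorname{supp}P_\pi}P_\pi(a)H_\pi(p_a)$, with $P_\pi=\sum_\theta\pi(\theta)P_\theta$ and $p_a(\theta)=\pi(\theta)P_\theta(a)/P_\pi(a)$. $P\in\Delta(A)^\Theta$ is optimal if it maximizes $\sum_\theta\pi(\theta)\sum_{a\in A}P_\theta(a)a(\theta)-C(P,\pi)$ over $\Delta(A)^\Theta$. The psychometric function is convex at $\theta_i$ if $P_{\theta_i}(r)-P_{\theta_{i-1}}(r)\le P_{\theta_{i+1}}(r)-P_{\theta_i}(r)$, and concave at $\theta_i$ if the reverse inequality holds. *)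

(* Defs.v *)
From HB Require Import structures.
From mathcomp Require Import all_boot all_order all_algebra.
From mathcomp Require Import all_classical all_reals all_analysis.

Set Implicit Arguments.
Unset Strict Implicit.
Unset Printing Implicit Defensive.

Import Order.TTheory GRing.Theory Num.Theory.
Local Open Scope classical_set_scope.
Local Open Scope ring_scope.

Definition is_dist (R : realType) (T : finType) (f : T -> R) : Prop :=
  (forall x, 0 <= f x) /\ \sum_x f x = 1.

Definition full_support (R : realType) (T : finType) (f : T -> R) : Prop :=
  forall x, 0 < f x.

(* Real-valued, hence meaningful only for [alpha] of full support, the only
   case in which it is used; the convention 0 log 0 = 0 holds. *)
Definition KL (R : realType) (T : finType) (beta alpha : T -> R) : R :=
  \sum_x beta x * ln (beta x / alpha x).

Definition affinely_independent (R : realType) (I T : finType)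
    (v : I -> T -> R) : Prop :=
  forall c : I -> R, \sum_i c i = 0 ->
    (forall t, \sum_i c i * v i t = 0) -> forall i, c i = 0.

(* [fosd f g]: f first-order stochastically dominates g. *)
Definition fosd (R : realType) (n : nat) (f g : 'I_n -> R) : Prop :=
  forall k : 'I_n, \sum_(i < n | (i <= k)%N) f i <= \sum_(i < n | (i <= k)%N) g i.

Definition nest_marginal (R : realType) (N Theta : finType)
    (nu : N * Theta -> R) (i : N) : R := \sum_t nu (i, t).

Definition state_marginal (R : realType) (N Theta : finType)
    (nu : N * Theta -> R) (t : Theta) : R := \sum_i nu (i, t).

Definition nest_structure (R : realType) (N Theta : finType)
    (pi : Theta -> R) (nu : N * Theta -> R) : Prop :=
  [/\ is_dist nu, full_support (nest_marginal nu)
    & forall t, state_marginal nu t = pi t].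

Definition state_given_nest (R : realType) (N Theta : finType)
    (nu : N * Theta -> R) (i : N) (t : Theta) : R :=
  nu (i, t) / nest_marginal nu i.

Definition nest_given_state (R : realType) (N Theta : finType)
    (pi : Theta -> R) (nu : N * Theta -> R) (t : Theta) (i : N) : R :=
  nu (i, t) / pi t.

(* [ereal_inf] of the empty set is +oo: the value when p is not a mixture of
   the conditional distributions. *)
Definition nest_entropy (R : realType) (N Theta : finType) (zeta : R)
    (nu : N * Theta -> R) (p : Theta -> R) : \bar R :=
  ereal_inf [set (zeta * KL mu (nest_marginal nu))%:E | mu in
    [set mu : N -> R | is_dist mu /\
      forall t, \sum_i mu i * state_given_nest nu i t = p t]].

Definition choice_rule (R : realType) (Theta A : finType)
    (P : Theta -> A -> R) : Prop := forall t, is_dist (P t).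

Definition choice_prob (R : realType) (Theta A : finType)
    (pi : Theta -> R) (P : Theta -> A -> R) (a : A) : R :=
  \sum_t pi t * P t a.

Definition posterior (R : realType) (Theta A : finType)
    (pi : Theta -> R) (P : Theta -> A -> R) (a : A) (t : Theta) : R :=
  pi t * P t a / choice_prob pi P a.

Definition ps_cost (R : realType) (Theta A : finType)
    (H : (Theta -> R) -> \bar R) (pi : Theta -> R) (P : Theta -> A -> R)
    : \bar R :=
  (\sum_(a | choice_prob pi P a != 0%R)
    (choice_prob pi P a)%:E * H (posterior pi P a))%E.

Definition net_payoff (R : realType) (Theta A : finType)
    (u : A -> Theta -> R) (H : (Theta -> R) -> \bar R) (pi : Theta -> R)
    (P : Theta -> A -> R) : \bar R :=
  ((\sum_t pi t * \sum_a P t a * u a t)%:E - ps_cost H pi P)%E.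

Definition optimal (R : realType) (Theta A : finType)
    (u : A -> Theta -> R) (H : (Theta -> R) -> \bar R) (pi : Theta -> R)
    (P : Theta -> A -> R) : Prop :=
  choice_rule P /\
  forall Q, choice_rule Q -> (net_payoff u H pi Q <= net_payoff u H pi P)%E.

(* In the discrimination task with n states, the state theta_(i+1) and the
   nest i+1 are both represented by their index i : 'I_n; [th i] is the real
   number theta_(i+1). The action set {r, s} is [bool], r being [true]. *)

Definition equally_spaced (R : realType) (n : nat) (th : 'I_n -> R) : Prop :=
  exists2 Delta : R, 0 < Delta &
    forall i j : 'I_n, j = i.+1 :> nat -> th j - th i = Delta.

Definition increasing_in_state (R : realType) (n : nat)
    (th f : 'I_n -> R) : Prop :=
  forall i j : 'I_n, th i <= th j -> f i <= f j.

Definition task_utility (R : realType) (n : nat) (r : 'I_n -> R)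
    (a : bool) (t : 'I_n) : R := if a then r t else 0.

Definition psychometric (R : realType) (n : nat) (P : 'I_n -> bool -> R)
    (t : 'I_n) : R := P t true.

(* For consecutive indices h, i, j: convexity/concavity of f at theta_i. *)
Definition convex_at (R : realType) (n : nat) (f : 'I_n -> R)
    (h i j : 'I_n) : Prop := f i - f h <= f j - f i.

Definition concave_at (R : realType) (n : nat) (f : 'I_n -> R)
    (h i j : 'I_n) : Prop := f j - f i <= f i - f h.

Definition MLRP (R : realType) (n : nat) (th : 'I_n -> R)
    (nu_ : 'I_n -> 'I_n -> R) : Prop :=
  forall (t u i j : 'I_n), th u <= th t -> (j <= i)%N ->
    nu_ u i * nu_ t j <= nu_ t i * nu_ u j.

Definition half_mix (R : realType) (T : Type) (f g : T -> R) (x : T) : R :=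
  2^-1 * f x + 2^-1 * g x.

(* Main.v *)
(** By affine independence every rule of finite cost comes from a choice rule
    [q] conditioned on the nest instead of the state, and its cost is [zeta]
    times the mutual information between nest and action. Replacing [q i] and
    [q j] by their [nest_marginal]-weighted average keeps the unconditional
    choice probabilities and, by strict convexity of [x ln x], strictly lowers
    the cost, so at an optimum [q] is increasing in the expected utility of [r]
    given the nest. Under the MLRP that utility increases with the nest, so
    [P_t(r)] is the mean of an increasing function of the nest under
    [nu_t], and stochastic dominance gives the three claims. *)

Require Import Defs.
From HB Require Import structures.
From mathcomp Require Import all_boot all_order all_algebra.
From mathcomp Require Import all_classical all_reals all_analysis.
From mathcomp Require Import ring lra.

Set Implicit Arguments.
Unset Strict Implicit.
Unset Printing Implicit Defensive.

Import Order.TTheory GRing.Theory Num.Theory.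
Local Open Scope ring_scope.

(** * Strict convexity of [x ln x] *)

Lemma ln_lt_sub1 (R : realType) (y : R) : 0 < y -> y != 1 -> ln y < y - 1.
Proof.
move=> y0 y1; rewrite ltrBrDl -{2}(lnK y0).
by apply: expR_gt1Dx; rewrite ln_eq0.
Qed.

(** This is [ln y < y - 1] at [y = m / x], multiplied by [x]. At [x = 0] the logarithmic term
    vanishes and positivity of [m] suffices. *)
Lemma xlnx_gt (R : realType) (x m : R) :
  0 <= x -> 0 < m -> x != m -> x - m < x * ln (x / m).
Proof.
move=> x0 m0 xm; case: (eqVneq x 0) => [->|xn0].
  by rewrite mul0r sub0r oppr_lt0.
have xp : 0 < x by rewrite lt_neqAle eq_sym xn0.
have := @ln_lt_sub1 R (m / x) (divr_gt0 m0 xp).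
rewrite -(inj_eq (mulIf xn0)) mul1r mulfVK // eq_sym => /(_ xm).
rewrite -[m / x]invf_div lnV ?posrE ?divr_gt0 // -(ltr_pM2l xp) invf_div.
rewrite mulrBr mulrCA divff // !mulr1 mulrN => H.
by rewrite -ltrN2 opprB.
Qed.

(** Splitting [ln (z / p)] as [ln (z / m) + ln (m / p)], the second parts add up to the left side
    because [m] is the weighted mean; by [xlnx_gt] the first parts exceed
    [b * (x - m) + c * (y - m) = 0]. *)
Lemma log_sum_lt (R : realType) (b c x y p m : R) : 0 < b -> 0 < c ->
  0 <= x -> 0 <= y -> 0 < p -> x != y -> m = (b * x + c * y) / (b + c) ->
  (b + c) * (m * ln (m / p)) < b * (x * ln (x / p)) + c * (y * ln (y / p)).
Proof.
move=> b0 c0 x0 y0 p0 xy mE.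
have bc0 : 0 < b + c by rewrite addr_gt0.
have bcm : (b + c) * m = b * x + c * y by rewrite mE mulrC divfK ?gt_eqF.
(* A zero mean would force [x] and [y] both to vanish, hence to coincide. *)
have m0 : 0 < m.
  rewrite lt_neqAle eq_sym; apply/andP; split; last first.
    by rewrite mE divr_ge0 ?addr_ge0 ?mulr_ge0 // ltW.
  apply: contra_neq xy => m0; move: bcm; rewrite m0 mulr0 => /esym/eqP.
  rewrite paddr_eq0 ?mulr_ge0 ?(ltW b0) ?(ltW c0) // !mulf_eq0.
  by rewrite (gt_eqF b0) (gt_eqF c0) /= => /andP[/eqP-> /eqP->].
have split_ln z : 0 <= z -> z * ln (z / p) = z * ln (z / m) + z * ln (m / p).
  move=> z0; case: (eqVneq z 0) => [->|zn0]; first by rewrite !mul0r addr0.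
  have zp : 0 < z by rewrite lt_neqAle eq_sym zn0.
  rewrite -mulrDr -lnM ?posrE ?divr_gt0 //; congr (_ * ln _).
  by rewrite mulrA divfK ?gt_eqF.
have xm : x != m.
  apply: contra_neq xy => xm; apply: (mulfI (lt0r_neq0 c0)).
  by move: bcm; rewrite -xm mulrDl => /addrI.
have ym : y != m.
  apply: contra_neq xy => ym; apply: (mulfI (lt0r_neq0 b0)).
  by move: bcm; rewrite -ym mulrDl => /addIr.
have := xlnx_gt x0 m0 xm; have := xlnx_gt y0 m0 ym.
rewrite (split_ln x x0) (split_ln y y0).
rewrite -(ltr_pM2l c0) => Hy; rewrite -(ltr_pM2l b0) => Hx.
move: bcm Hx Hy; move: (ln (x / m)) (ln (y / m)) (ln (m / p)) => A B D.
move=> bcm Hx Hy; have : (b + c) * (m * D) = (b * x + c * y) * D.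
  by rewrite mulrA bcm.
nra.
Qed.

(** * Expectations under likelihood-ratio and stochastic dominance *)

(** Chebyshev's symmetrization: twice the difference of the two sides is a double sum of
    [(f i * g j - f j * g i) * (q i - q j)], whose factors always agree in sign. It serves both for
    states given a nest and for nests given a state. *)
Lemma sum_lr_monotone (R : realType) (n : nat) (f g q : 'I_n -> R) :
  (forall i j : 'I_n, (j <= i)%N -> f j * g i <= f i * g j) ->
  (forall i j : 'I_n, (j <= i)%N -> q j <= q i) ->
  (\sum_i g i * q i) * \sum_i f i <= (\sum_i f i * q i) * \sum_i g i.
Proof.
move=> fg qm.
have E1 : (\sum_i g i * q i) * (\sum_i f i) = \sum_i \sum_j g i * q i * f j.
  by rewrite mulr_suml; apply: eq_bigr => i _; rewrite mulr_sumr.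
have E2 : (\sum_i f i * q i) * (\sum_i g i) = \sum_i \sum_j f i * q i * g j.
  by rewrite mulr_suml; apply: eq_bigr => i _; rewrite mulr_sumr.
have E1' : (\sum_i g i * q i) * (\sum_i f i) = \sum_i \sum_j g j * q j * f i.
  by rewrite E1 exchange_big.
have E2' : (\sum_i f i * q i) * (\sum_i g i) = \sum_i \sum_j f j * q j * g i.
  by rewrite E2 exchange_big.
have E : (\sum_i \sum_j (f i * g j - f j * g i) * (q i - q j)) =
  ((\sum_i f i * q i) * (\sum_i g i) - (\sum_i g i * q i) * (\sum_i f i)) *+ 2.
  rewrite mulr2n [in X in X + _]E1 [in X in X + _]E2 E1' E2'.
  rewrite -!sumrB -big_split /=; apply: eq_bigr => i _.
  by rewrite -!sumrB -big_split /=; apply: eq_bigr => j _; ring.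
rewrite -subr_ge0 -(pmulrn_lge0 _ (n := 2)) // -E.
apply: sumr_ge0 => i _; apply: sumr_ge0 => j _.
case: (leqP j i) => ij; first by rewrite mulr_ge0 // subr_ge0; [exact: fg|exact: qm].
by rewrite mulr_le0 // subr_le0; [exact: fg (ltnW ij)|exact: qm (ltnW ij)].
Qed.

(** Summation by parts, by induction: all terms but the last are bounded by the penultimate value of
    [q] times a nonnegative partial sum, and that value can be raised to [q ord_max]. *)
Lemma abel_sum_le (R : realType) (n : nat) (d q : 'I_n.+1 -> R) :
  (forall k : 'I_n.+1, 0 <= \sum_(i < n.+1 | (i <= k)%N) d i) ->
  (forall i j : 'I_n.+1, (j <= i)%N -> q j <= q i) ->
  \sum_i d i * q i <= q ord_max * \sum_i d i.
Proof.
elim: n d q => [|n IHn] d q dk qm.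
  by rewrite !big_ord_recl !big_ord0 !addr0 mulrC (_ : ord0 = ord_max) //; apply: val_inj.
have dk' (k : 'I_n.+1) : \sum_(i < n.+1 | (i <= k)%N) d (widen_ord (leqnSn n.+1) i)
    = \sum_(i < n.+2 | (i <= widen_ord (leqnSn n.+1) k)%N) d i.
  rewrite big_mkcond [RHS]big_mkcond [RHS]big_ord_recr /=.
  by rewrite [(n < k)%N]ltnNge leq_ord addr0.
have D0 : 0 <= \sum_(i < n.+1) d (widen_ord (leqnSn n.+1) i).
  have := dk (widen_ord (leqnSn n.+1) ord_max); rewrite -dk'.
  by under eq_bigl do rewrite leq_ord.
rewrite !(big_ord_recr n.+1) /= mulrDr [d ord_max * _]mulrC lerD2r.
apply: le_trans (IHn (d \o widen_ord _) (q \o widen_ord _) _ _) _ => /=.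
- by move=> k; rewrite dk'.
- by move=> i j ij; apply: qm.
- by apply: ler_wpM2r => //; apply: qm; rewrite /= ltnW.
Qed.

(** The differences [g i - f i] have nonnegative partial sums and total zero, so the bound of
    [abel_sum_le] is zero. *)
Lemma fosd_sum_le (R : realType) (n : nat) (f g q : 'I_n -> R) :
  fosd f g -> \sum_i f i = \sum_i g i ->
  (forall i j : 'I_n, (j <= i)%N -> q j <= q i) ->
  \sum_i g i * q i <= \sum_i f i * q i.
Proof.
case: n f g q => [|n] f g q fg efg qm; first by rewrite !big_ord0.
rewrite -subr_le0 -sumrB; under eq_bigr do rewrite -mulrBl.
apply: le_trans (abel_sum_le _ qm) _; last by rewrite sumrB efg subrr mulr0.
by move=> k; rewrite sumrB subr_ge0.
Qed.

Lemma sum_sub_off2 (R : realType) (N : finType) (f g : N -> R) (i j : N) :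
  i != j -> (forall k, k != i -> k != j -> f k = g k) ->
  \sum_k f k - \sum_k g k = (f i - g i) + (f j - g j).
Proof.
move=> ij fg; have ji : j != i by rewrite eq_sym.
rewrite -sumrB (bigD1 i) //= (bigD1 j) //= big1 ?addr0 // => k /andP[ki kj].
by rewrite fg // subrr.
Qed.

(** * Choice rules that condition on the nest *)

Section NestRules.
Variables (R : realType) (N Theta A : finType).
Variables (pi : Theta -> R) (nu : N * Theta -> R) (zeta : R).
Hypothesis pi_gt0 : full_support pi.
Hypothesis nuP : nest_structure pi nu.

Local Notation b := (nest_marginal nu).

Let b_gt0 i : 0 < b i. Proof. by case: nuP => _ /(_ i). Qed.
Let b_ge0 i : 0 <= b i. Proof. exact: ltW. Qed.
Let b_neq0 i : b i != 0. Proof. exact: lt0r_neq0. Qed.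
Let pi_neq0 t : pi t != 0. Proof. exact: lt0r_neq0 (pi_gt0 t). Qed.
Let pi_ge0 t : 0 <= pi t. Proof. exact: ltW (pi_gt0 t). Qed.
Let nu_ge0 x : 0 <= nu x. Proof. by case: nuP => -[/(_ x)]. Qed.

Lemma sum_nest_marginal : \sum_i b i = 1.
Proof. by case: nuP => -[_ <-] _ _; rewrite pair_bigA; apply: eq_bigr => -[]. Qed.

Lemma sum_state_given_nest i : \sum_t state_given_nest nu i t = 1.
Proof. by rewrite -mulr_suml divff ?b_neq0. Qed.

Lemma sum_nest_given_state t : \sum_i nest_given_state pi nu t i = 1.
Proof.
rewrite -mulr_suml; case: nuP => _ _ /(_ t); rewrite /state_marginal => ->.
by rewrite divff.
Qed.

Lemma nest_marginal_mix t : \sum_i b i * state_given_nest nu i t = pi t.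
Proof.
case: nuP => _ _ <-; apply: eq_bigr => i _.
by rewrite /state_given_nest mulrC divfK.
Qed.

(* Nest [i] is drawn given the state, then the action according to [q i]. *)
Definition nest_rule (q : N -> A -> R) (t : Theta) (a : A) : R :=
  \sum_i nest_given_state pi nu t i * q i a.

Definition nest_choice_prob (q : N -> A -> R) (a : A) : R := \sum_i b i * q i a.

Lemma choice_rule_nest_rule q : choice_rule q -> choice_rule (nest_rule q).
Proof.
move=> qP t; split=> [a|].
  apply: sumr_ge0 => i _; rewrite mulr_ge0 //; last by case: (qP i).
  by rewrite /nest_given_state divr_ge0.
rewrite exchange_big /= -(sum_nest_given_state t); apply: eq_bigr => i _.
by rewrite -mulr_sumr; case: (qP i) => _ ->; rewrite mulr1.
Qed.

(** Both sides are the joint probability of state and action with the nest summed out; Bayes' rule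
    exchanges the two conditionings. *)
Lemma pi_nest_rule q t a :
  pi t * nest_rule q t a = \sum_i (b i * q i a) * state_given_nest nu i t.
Proof.
rewrite mulr_sumr; apply: eq_bigr => i _.
rewrite /nest_given_state /state_given_nest.
by field; rewrite pi_neq0 b_neq0.
Qed.

Lemma choice_prob_nest_rule q a :
  choice_prob pi (nest_rule q) a = nest_choice_prob q a.
Proof.
rewrite /choice_prob; under eq_bigr do rewrite pi_nest_rule.
rewrite exchange_big; apply: eq_bigr => i _.
by rewrite -mulr_sumr sum_state_given_nest mulr1.
Qed.

Lemma posterior_nest_rule q a t :
  \sum_i (b i * q i a / nest_choice_prob q a) * state_given_nest nu i t
  = posterior pi (nest_rule q) a t.
Proof.
rewrite /posterior pi_nest_rule choice_prob_nest_rule mulr_suml.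
by apply: eq_bigr => i _; rewrite mulrAC.
Qed.

Lemma payoff_nest_rule (u : A -> Theta -> R) q :
  \sum_t pi t * (\sum_a nest_rule q t a * u a t) =
  \sum_i \sum_a b i * q i a * \sum_t state_given_nest nu i t * u a t.
Proof.
transitivity (\sum_t \sum_a \sum_i
    b i * q i a * (state_given_nest nu i t * u a t)).
  apply: eq_bigr => t _; rewrite mulr_sumr; apply: eq_bigr => a _.
  rewrite mulrA pi_nest_rule mulr_suml; apply: eq_bigr => i _.
  by rewrite mulrA.
rewrite exchange_big /= [RHS]exchange_big /=; apply: eq_bigr => a _.
rewrite exchange_big /=; apply: eq_bigr => i _.
by rewrite mulr_sumr.
Qed.

(** The contribution of action [a] to the mutual information between nest and action. *)
Definition nest_information (q : N -> A -> R) (a : A) : R :=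
  \sum_i b i * (q i a * ln (q i a / nest_choice_prob q a)).

(** * The cost under affine independence *)

Hypothesis indep : affinely_independent (state_given_nest nu).

(** Independence makes the mixing weights of [p] unique, so the infimum runs over a singleton. *)
Lemma nest_entropy_mixture (mu : N -> R) (p : Theta -> R) : is_dist mu ->
  (forall t, \sum_i mu i * state_given_nest nu i t = p t) ->
  nest_entropy zeta nu p = (zeta * KL mu b)%:E.
Proof.
move=> muP mup; rewrite /nest_entropy.
rewrite (_ : [set _ | _ in _]%classic = [set (zeta * KL mu b)%:E]%classic)
  ?ereal_inf1 //.
apply/seteqP; split=> [_ /= [mu' [mu'P mu'p] <-]|_ /= ->]; last by exists mu.
congr (zeta * KL _ _)%:E; apply/funext => i; apply/eqP; rewrite -subr_eq0.
apply/eqP; apply: (indep (c := fun i => mu' i - mu i)) => [|t].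
  by rewrite sumrB; case: muP => _ ->; case: mu'P => _ ->; rewrite subrr.
by under eq_bigr do rewrite mulrBl; rewrite sumrB mup mu'p subrr.
Qed.

Lemma nest_choice_prob_ge0 q a : choice_rule q -> 0 <= nest_choice_prob q a.
Proof.
move=> qP; apply: sumr_ge0 => i _; rewrite mulr_ge0 //.
by case: (qP i).
Qed.

Lemma nest_information_eq0 q a :
  nest_choice_prob q a = 0 -> nest_information q a = 0.
Proof.
move=> q0; rewrite /nest_information q0 big1 // => i _.
(* The inverse of zero is zero, and so is [ln 0]. *)
by rewrite invr0 mulr0 ln0 // !mulr0.
Qed.

Lemma ps_cost_nest_rule q : choice_rule q ->
  ps_cost (nest_entropy zeta nu) pi (nest_rule q)
  = (zeta * \sum_a nest_information q a)%:E.
Proof.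
move=> qP; rewrite mulr_sumr -sumEFin /ps_cost big_mkcond /=.
apply: eq_bigr => a _; rewrite choice_prob_nest_rule.
case: eqP => [q0|/eqP qn0] /=; first by rewrite nest_information_eq0 ?mulr0.
have qa0 := nest_choice_prob_ge0 a qP.
rewrite (nest_entropy_mixture _ (posterior_nest_rule q a)); last first.
  split=> [i|]; last by rewrite -mulr_suml divff.
  by rewrite divr_ge0 // mulr_ge0 //; case: (qP i).
rewrite -EFinM mulrCA; congr (_ * _)%:E; rewrite /KL mulr_sumr.
apply: eq_bigr => i _.
(* The nest's posterior over its prior is the action's conditional probability over its
   unconditional one. *)
rewrite [b i * q i a / _ / b i](_ : _ = q i a / nest_choice_prob q a); last first.
  by field; rewrite b_neq0 qn0.
by move: (ln _) => L; field.
Qed.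

Lemma net_payoff_nest_rule (u : A -> Theta -> R) q : choice_rule q ->
  net_payoff u (nest_entropy zeta nu) pi (nest_rule q) =
  ((\sum_i \sum_a b i * q i a * \sum_t state_given_nest nu i t * u a t)
   - zeta * \sum_a nest_information q a)%:E.
Proof. by move=> qP; rewrite /net_payoff ps_cost_nest_rule // payoff_nest_rule. Qed.

(** * Rules of finite cost and optimal rules *)

Lemma finite_entropy_mixture p : (nest_entropy zeta nu p < +oo)%E ->
  exists mu : N -> R, is_dist mu /\
    forall t, \sum_i mu i * state_given_nest nu i t = p t.
Proof.
by move=> /ereal_inf_lt[_ [mu muP _] _]; exists mu.
Qed.

(** This lets a single infinite term make the whole cost infinite. *)
Lemma nest_entropy_gtNy p : (-oo < nest_entropy zeta nu p)%E.
Proof.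
have [fin|] := ltP (nest_entropy zeta nu p) +oo%E.
  have [mu [muP mup]] := finite_entropy_mixture fin.
  by rewrite (nest_entropy_mixture muP mup) ltNyr.
by rewrite leye_eq => /eqP ->.
Qed.

(** Finite cost makes the posterior of every chosen action a mixture of nest conditionals; Bayes'
    rule turns the mixing weights into action probabilities given the nest. *)
Lemma finite_cost_nest_rule (P : Theta -> A -> R) : is_dist pi ->
  choice_rule P -> (ps_cost (nest_entropy zeta nu) pi P < +oo)%E ->
  exists2 q, choice_rule q & P = nest_rule q.
Proof.
move=> piP PP cfin.
have pr0 a : 0 <= choice_prob pi P a.
  by apply: sumr_ge0 => t _; rewrite mulr_ge0 //; case: (PP t).
have /choice[mu muP] a : exists mu : N -> R, is_dist mu /\
    forall t, choice_prob pi P a * \sum_i mu i * state_given_nest nu i t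
      = pi t * P t a.
  have [p0|pn0] := eqVneq (choice_prob pi P a) 0.
    (* An action that is never chosen has weight zero, so any distribution on nests serves. *)
    exists b; split; first by split=> [i|]; [exact: ltW|exact: sum_nest_marginal].
    move=> t; rewrite p0 mul0r; move/eqP: p0.
    rewrite psumr_eq0 => [/allP/(_ t)|s _].
      by rewrite mem_index_enum => /(_ isT)/eqP.
    by rewrite mulr_ge0 //; case: (PP s).
  have pp : 0 < choice_prob pi P a by rewrite lt_neqAle eq_sym pn0 pr0.
  have [|mu [mud mup]] := @finite_entropy_mixture (posterior pi P a).
    rewrite ltNge; apply/negP; rewrite leye_eq => /eqP Hoo.
    suff : ps_cost (nest_entropy zeta nu) pi P = +oo%E by move=> E; rewrite E in cfin.
    rewrite /ps_cost; apply/eqP; rewrite esum_eqy; last first.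
      move=> a' /= an0; have pp' : 0 < choice_prob pi P a'.
        by rewrite lt_neqAle eq_sym an0 pr0.
      have := nest_entropy_gtNy (posterior pi P a').
      case: (nest_entropy _ _ _) => [x|//|//] _; first by rewrite -EFinM.
      by rewrite gt0_muley ?lte_fin.
    by apply/existsP; exists a; rewrite unfold_in pn0 Hoo gt0_muley ?lte_fin ?eqxx.
  exists mu; split=> // t; rewrite mup /posterior mulrC divfK //.
exists (fun i a => choice_prob pi P a * mu a i / b i) => [i|].
  split=> [a|]; first by rewrite divr_ge0 ?mulr_ge0 //; case: (muP a) => -[].
  rewrite -mulr_suml; apply/eqP; rewrite -(inj_eq (mulIf (b_neq0 i))).
  rewrite divfK // mul1r -subr_eq0; apply/eqP.
  (* The averaged weights of the [mu a] and the weights [b] both mix the nest conditionals to [pi],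
     so they coincide; hence the action probabilities at each nest sum to one. *)
  apply: (indep (c := fun i => \sum_a choice_prob pi P a * mu a i - b i)) => [|t].
    rewrite sumrB sum_nest_marginal exchange_big /=.
    under eq_bigr => a _ do [rewrite -mulr_sumr; case: (muP a) => -[_ ->] _; rewrite mulr1].
    rewrite exchange_big /=; case: piP => _ <-; apply/eqP; rewrite subr_eq0.
    by apply/eqP/eq_bigr => t _; rewrite -mulr_sumr; case: (PP t) => _ ->; rewrite mulr1.
  under eq_bigr do rewrite mulrBl; rewrite sumrB nest_marginal_mix.
  under eq_bigr do rewrite mulr_suml; rewrite exchange_big /=.
  under eq_bigr => a _ do
    [under eq_bigr do rewrite -mulrA; rewrite -mulr_sumr; case: (muP a) => _ ->].
  by rewrite -mulr_sumr; case: (PP t) => _ ->; rewrite mulr1 subrr.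
apply/funext => t; apply/funext => a; apply: (mulfI (pi_neq0 t)).
case: (muP a) => _ <-; rewrite pi_nest_rule mulr_sumr; apply: eq_bigr => i _.
by rewrite mulrA; congr (_ * _); rewrite [RHS]mulrC divfK.
Qed.

(** Every nest rule has a real net payoff, whereas infinite cost gives [-oo]; an optimum therefore
    has finite cost. *)
Lemma optimal_nest_rule (u : A -> Theta -> R) (P : Theta -> A -> R) :
  is_dist pi -> optimal u (nest_entropy zeta nu) pi P ->
  exists2 q, choice_rule q & P = nest_rule q.
Proof.
move=> piP [PP Popt]; apply: finite_cost_nest_rule => //.
rewrite ltNge leye_eq; apply/negP => /eqP Coo.
have [t0|no_state] := pickP (@predT Theta); last first.
  by case: piP => _ /eqP; rewrite big_pred0 // eq_sym oner_eq0.
(* The competitor ignores the nest; an arbitrary row of [P] supplies its distribution on actions. *)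
have q0P : choice_rule (fun (_ : N) a => P t0 a) by move=> i; exact: PP.
have := Popt _ (choice_rule_nest_rule q0P).
by rewrite net_payoff_nest_rule // /net_payoff Coo leeNy_eq.
Qed.

(* Pooling the choice probabilities of [i] and [j] at their weighted average
   preserves the unconditional choice probabilities, changes the expected
   utility by a nonnegative multiple of minus the sum in the hypothesis, and
   strictly lowers the information cost unless [q i = q j]. *)
Lemma optimal_nest_rule_eq (u : A -> Theta -> R) (q : N -> A -> R) (i j : N) :
  let v k a := \sum_t state_given_nest nu k t * u a t in
  0 < zeta -> choice_rule q ->
  optimal u (nest_entropy zeta nu) pi (nest_rule q) ->
  \sum_a (q i a - q j a) * (v i a - v j a) <= 0 -> q i =1 q j.
Proof.
move=> v zeta0 qP [_ qopt] le0 a0; apply/eqP; apply: contraT => qa0.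
have ij : i != j by apply: contra_neq qa0 => ->.
have q_ge0 k a : 0 <= q k a by case: (qP k).
have bb0 : 0 < b i + b j by rewrite addr_gt0.
have bb_ge0 : 0 <= b i + b j by exact: ltW.
have bb_neq0 : b i + b j != 0 by exact: lt0r_neq0.
pose m a := (b i * q i a + b j * q j a) / (b i + b j).
have mE a : m a * (b i + b j) = b i * q i a + b j * q j a.
  by rewrite /m divfK.
pose q' k a := if (k == i) || (k == j) then m a else q k a.
have q'i a : q' i a = m a by rewrite /q' eqxx.
have q'j a : q' j a = m a by rewrite /q' eqxx orbT.
have q'o k a : k != i -> k != j -> q' k a = q k a.
  by rewrite /q' => /negbTE-> /negbTE->.
have q'P : choice_rule q'.
  move=> k; rewrite /is_dist /q'; case: (_ || _); last exact: qP.
  split=> [a|]; first by rewrite divr_ge0 // addr_ge0 // mulr_ge0.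
  rewrite -mulr_suml big_split /= -!mulr_sumr.
  by case: (qP i) => _ ->; case: (qP j) => _ ->; rewrite !mulr1 divff.
have prE a : nest_choice_prob q' a = nest_choice_prob q a.
  apply/eqP; rewrite -subr_eq0 (@sum_sub_off2 _ _ _ _ i j) //; last first.
    by move=> k ki kj; rewrite q'o.
  by rewrite q'i q'j; apply/eqP; have := mE a; lra.
have infoE a : nest_information q' a - nest_information q a =
    (b i + b j) * (m a * ln (m a / nest_choice_prob q a)) -
    (b i * (q i a * ln (q i a / nest_choice_prob q a)) +
     b j * (q j a * ln (q j a / nest_choice_prob q a))).
  rewrite /nest_information prE (@sum_sub_off2 _ _ _ _ i j) //; last first.
    by move=> k ki kj; rewrite q'o.
  by rewrite q'i q'j; ring.
have pr_gt0 a : q i a != q j a -> 0 < nest_choice_prob q a.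
  move=> qa; rewrite lt_neqAle nest_choice_prob_ge0 // andbT eq_sym.
  (* Since [b] has full support, an action of total probability zero has probability zero at every
     nest. *)
  apply: contra_neq qa => /eqP; rewrite psumr_eq0 => [/allP H|k _]; last first.
    by rewrite mulr_ge0.
  have H0 k : q k a = 0.
    have := H k; rewrite mem_index_enum => /(_ isT).
    by rewrite mulf_eq0 (negbTE (b_neq0 k)) => /eqP.
  by rewrite !H0.
have info_lt a : q i a != q j a -> nest_information q' a < nest_information q a.
  move=> qa; rewrite -subr_lt0 infoE subr_lt0.
  by apply: log_sum_lt => //; exact: pr_gt0.
have info_le a : nest_information q' a <= nest_information q a.
  have [qa|/info_lt/ltW//] := eqVneq (q i a) (q j a).
  have ma : m a = q j a by rewrite /m qa -mulrDl mulrC mulKf.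
  by rewrite -subr_le0 infoE ma qa; lra.
have info_sum : \sum_a nest_information q' a < \sum_a nest_information q a.
  rewrite (bigD1 a0) //= [ltRHS](bigD1 a0) //= ltr_leD ?info_lt //.
  by apply: ler_sum => a _; exact: info_le.
have pay : \sum_k \sum_a b k * q k a * v k a <= \sum_k \sum_a b k * q' k a * v k a.
  rewrite -subr_ge0 (@sum_sub_off2 _ _ _ _ i j) //; last first.
    by move=> k ki kj; apply: eq_bigr => a _; rewrite q'o.
  rewrite -!sumrB -big_split /=.
  (* The factor comes from [m a - q i a = b j * (q j a - q i a) / (b i + b j)] and its mirror image
     for [j]. *)
  rewrite (eq_bigr (fun a => - (b i * b j / (b i + b j)) *
    ((q i a - q j a) * (v i a - v j a)))) => [|a _].
    rewrite -mulr_sumr mulNr -mulrN mulr_ge0 ?oppr_ge0 //.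
    by rewrite divr_ge0 // mulr_ge0.
  by rewrite q'i q'j /m; field.
have := qopt _ (choice_rule_nest_rule q'P).
rewrite !net_payoff_nest_rule // lee_fin -/v.
have : zeta * \sum_a nest_information q' a < zeta * \sum_a nest_information q a.
  by rewrite ltr_pM2l.
move: pay; rewrite /v; lra.
Qed.

End NestRules.

(** * The discrimination task *)

Lemma equally_spaced_le (R : realType) (n : nat) (th : 'I_n -> R) :
  equally_spaced th -> forall i j : 'I_n, (th i <= th j) = (i <= j)%N.
Proof.
move=> [D D0 thS].
have thE (i : 'I_n) k (H : (i + k < n)%N) : th (Ordinal H) = th i + D *+ k.
  elim: k H => [|k IHk] H.
    by rewrite addr0; congr th; apply: val_inj; rewrite /= addn0.
  have H' : (i + k < n)%N by apply: ltn_trans H; rewrite addnS.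
  have /eqP := thS (Ordinal H') (Ordinal H) (addnS i k).
  by rewrite subr_eq IHk => /eqP ->; rewrite mulrS; ring.
have mono (i j : 'I_n) : (i < j)%N -> th i < th j.
  move=> ij; have H : (i + (j - i) < n)%N by rewrite subnKC // ltnW.
  rewrite (_ : j = Ordinal H); last by apply: val_inj; rewrite /= subnKC // ltnW.
  by rewrite thE ltrDl pmulrn_lgt0 // subn_gt0.
move=> i j; have [ij|ji|/val_inj->] := ltngtP i j; last exact: lexx.
  by rewrite ltW ?mono.
by rewrite leNgt mono.
Qed.

Theorem proposition16 (R : realType) (n : nat) (th : 'I_n -> R)
    (pi r : 'I_n -> R) (nu : 'I_n * 'I_n -> R) (zeta : R)
    (P : 'I_n -> bool -> R)
    (Hth : equally_spaced th)
    (Hpi : is_dist pi) (Hpi_full : full_support pi)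
    (Hr : increasing_in_state th r)
    (Hnu : nest_structure pi nu)
    (Hzeta : 0 < zeta)
    (Hindep : affinely_independent (state_given_nest nu))
    (HP : optimal (task_utility r) (nest_entropy zeta nu) pi P) :
  let nu_ := nest_given_state pi nu in
  [/\ MLRP th nu_ -> increasing_in_state th (psychometric P),
      MLRP th nu_ ->
        forall h i j : 'I_n, i = h.+1 :> nat -> j = i.+1 :> nat ->
          fosd (half_mix (nu_ h) (nu_ j)) (nu_ i) ->
          convex_at (psychometric P) h i j
    & MLRP th nu_ ->
        forall h i j : 'I_n, i = h.+1 :> nat -> j = i.+1 :> nat ->
          fosd (nu_ i) (half_mix (nu_ h) (nu_ j)) ->
          concave_at (psychometric P) h i j].
Proof.
move=> nu_; have [q qP PE] := optimal_nest_rule Hpi_full Hnu Hindep Hpi HP.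
have thE := equally_spaced_le Hth.
have b_gt0 i : 0 < nest_marginal nu i by case: Hnu => _ /(_ i).
have psE t : psychometric P t = \sum_i nu_ t i * q i true by rewrite PE.
have nu_sum t : \sum_i nu_ t i = 1 by exact: sum_nest_given_state.
have mix_avg (x : 'I_n -> R) h j : \sum_i half_mix (nu_ h) (nu_ j) i * x i =
    2^-1 * \sum_i nu_ h i * x i + 2^-1 * \sum_i nu_ j i * x i.
  by rewrite !mulr_sumr -big_split /=; apply: eq_bigr => i _; rewrite /half_mix; ring.
have mix_sum h j : \sum_i half_mix (nu_ h) (nu_ j) i = 1.
  by rewrite big_split /= -!mulr_sumr !nu_sum; field.
have q_mono : MLRP th nu_ ->
    forall i j : 'I_n, (j <= i)%N -> q j true <= q i true.
  move=> mlrp i j ji.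
  have v_mono : \sum_t state_given_nest nu j t * r t
      <= \sum_t state_given_nest nu i t * r t.
    have /(_ r) := @sum_lr_monotone _ _ (state_given_nest nu i) (state_given_nest nu j).
    rewrite !(sum_state_given_nest Hnu) !mulr1; apply=> [t u ut|t u ut]; last first.
      by apply: Hr; rewrite thE.
    have := mlrp t u i j; rewrite thE => /(_ ut ji).
    (* Each side carries the same product of marginals, so the MLRP for nests given states is also
       one for states given nests. *)
    rewrite /nu_ /nest_given_state /state_given_nest !mulf_div.
    rewrite ler_pM2r ?invr_gt0 ?mulr_gt0 // [pi t * pi u]mulrC.
    by rewrite ler_pM2r ?invr_gt0 ?mulr_gt0.
  (* If the lower nest [j] chose [r] more often, [optimal_nest_rule_eq] would apply, the safe action
     contributing nothing, and force equality. *)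
  rewrite leNgt; apply/negP => qlt; move: (qlt).
  rewrite PE in HP.
  rewrite (@optimal_nest_rule_eq _ _ _ _ _ _ _ Hpi_full Hnu Hindep _ _ i j Hzeta qP HP).
    by rewrite ltxx.
  have safe k : \sum_t state_given_nest nu k t * 0 = 0 :> R.
    by rewrite -mulr_suml mulr0.
  rewrite big_bool /= !safe subrr mulr0 addr0.
  by rewrite mulr_le0_ge0 ?subr_ge0 // subr_le0 ltW.
split=> mlrp.
- move=> u t ut; rewrite !psE.
  have := @sum_lr_monotone _ _ (nu_ t) (nu_ u) (q^~ true).
  rewrite !nu_sum !mulr1; apply; last exact: q_mono.
  by move=> i j ji; rewrite mulrC [leRHS]mulrC; have := mlrp _ _ _ _ ut ji; lra.
(* The mean of [q^~ true] under the half mixture is the average of the outer two psychometric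
   values, so dominance compares it with the middle one. *)
- move=> h i j _ _ /(@fosd_sum_le _ _ _ _ (q^~ true)).
  rewrite mix_sum nu_sum mix_avg -!psE => /(_ erefl (q_mono mlrp)).
  by rewrite /convex_at; lra.
- move=> h i j _ _ /(@fosd_sum_le _ _ _ _ (q^~ true)).
  rewrite mix_sum nu_sum mix_avg -!psE => /(_ erefl (q_mono mlrp)).
  by rewrite /concave_at; lra.
Qed.
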